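(* Assume a Turing instability occurs at $\mu=0$, and consider the stripes on the domain $[0,4\pi/\kappa]\times[0,4\pi/(\sqrt3\kappa)]$ ($\kappa=k_c+\tilde\kappa$, rescaled to $\Omega_3=[0,4\pi]\times[0,4\pi/\sqrt3]$) with periodic boundary conditions, scaling $(A,\alpha,\beta,\tilde\kappa)=(\varepsilon A',\varepsilon^2\alpha',\varepsilon\beta',\varepsilon\kappa')$, and velocity parameter $c=c(\mu)=-\lambda_\beta+\mathcal{O}(\varepsilon)$ of the stripes. Assume in addition that $Q[\cdot,\cdot]=\varepsilon Q'[\cdot,\cdot]$ with $Q'$ bounded in $\varepsilon$, and write $q=\varepsilon q'$. Then the eigenvalues of the matrix $L_2^{\rm hex}$ (the subblock of the linearisation in stripes defined in the context) are given by $$\lambda_{\rm hex}^\pm=\varepsilon^2\left(3k_0\tilde A'^2-\frac34\rho_\beta\beta'^2\pm2\tilde A'|q'|+\mathcal{O}(\varepsilon)\right),$$ where $\tilde A':=\sqrt{-(\alpha'+\rho_\beta\beta'^2+\rho_\kappa\kappa'^2)/(3k_0)}$. In particular, $\lambda_{\rm hex}^\pm\in\mathbb{R}$.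
   Context: System: $u_t=D\Delta u+Lu+\check\alpha Mu+\beta Bu_x+Q[u,u]+K[u,u,u]$, $u\in\mathbb{R}^2$, $\mathbf{x}=(x,y)\in\mathbb{R}^2$; $D=\mathrm{diag}(d_1,d_2)$, $d_i>0$; $L=\begin{pmatrix}a_1&a_2\\ a_3&a_4\end{pmatrix}$ and $M$ real $2\times2$ matrices; $Q$, $K$ symmetric bilinear/trilinear on $\mathbb{R}^2$, extended multilinearly to $\mathbb{C}^2$; $B=B(c)=\mathrm{diag}(1+c,c)$ with $c\in\mathbb{R}$. Turing instability with wavenumber $k_c>0$ at $\check\alpha=\beta=0$: with $\hat{\mathcal L}(k,\ell)=-(k^2+\ell^2)D+L+\check\alpha M+\mathrm{i}k\beta B$ and $d(\lambda,k,\ell)=\det(\hat{\mathcal L}(k,\ell)-\lambda\,\mathrm{Id})$, at $\check\alpha=\beta=0$: (1) all eigenvalues of $L$ have negative real part; (2) $d=0$ and $\mathrm{Re}\,\lambda\ge0$ iff $\lambda=0$ and $k^2+\ell^2=k_c^2$; (3) $\partial_\lambda d\ne0$ there. Set $\lambda_M:=-\partial_{\check\alpha}d/\partial_\lambda d$ (at $\check\alpha=0,\lambda=0$), assumed nonzero, and $\alpha:=\lambda_M\check\alpha$. Coefficients: $E_0,E_0^*\in\mathbb{R}^2$ span the kernels of $-k_c^2D+L$ and its transpose, $\langle E_0,E_0\rangle=\langle E_0,E_0^*\rangle=1$. $(-k_c^2D+L)^{-1}$ denotes the inverse from the range to the kernel of the projection $\langle\cdot,E_0^*\rangle E_0$.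 All coefficients are evaluated at $\mu=0$, where $c=-\lambda_\beta$, $\lambda_\beta=\frac{a_4-k_c^2d_2}{a_1+a_4-k_c^2(d_1+d_2)}$, so $\langle BE_0,E_0^*\rangle=0$. Define $Q_0=-2L^{-1}Q[\overline{E_0},E_0]$, $Q_2=-2(-4k_c^2D+L)^{-1}Q[E_0,E_0]$, $q_0=\langle Q[E_0,Q_0],E_0^*\rangle$, $q_2=\langle Q[\overline{E_0},Q_2],E_0^*\rangle$, $k_0=\langle K[E_0,E_0,\overline{E_0}],E_0^*\rangle$, $\rho_{\rm nl}=3k_0+2q_0+q_2$, $w_{A\beta}=k_c(-k_c^2D+L)^{-1}(\langle BE_0,E_0^*\rangle-B)E_0$, $w_{A\kappa}=2k_c(-k_c^2D+L)^{-1}DE_0$, $\rho_\beta=-k_c\langle Bw_{A\beta},E_0^*\rangle>0$, $\rho_\kappa=-2k_c\langle Dw_{A\kappa},E_0^*\rangle<0$. Standing assumption: $\rho_{\rm nl}<0$ (so, when $Q=\varepsilon Q'$, also $k_0<0$). Scaling: as in the claim, with $0<\varepsilon\ll1$ and primed quantities bounded; $\mu=(\alpha,\beta,\tilde\kappa)=\varepsilon\mu_1+\varepsilon^2\mu_2$, so $\mu_1$ carries $(\beta',\kappa')$. Stripes (known existence result): nontrivial small travelling waves constant in $y$, $2\pi/\kappa$-periodic in $x$, velocity $\beta c$ with $c=c(\mu)=-\lambda_\beta+\mathcal{O}(\varepsilon)$, leading-order profile $2\varepsilon A'E_0\cos(\kappa x)$ up to translation, in 1-to-1 correspondence with solutions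 $A=\varepsilon A'>0$ of $\varepsilon^2(\alpha'+\rho_\beta\beta'^2+\rho_\kappa\kappa'^2+\rho_{\rm nl}A'^2+\mathcal{O}(\varepsilon))=0$. The matrix $L_2^{\rm hex}$: on $\Omega_3$ there is a six-dimensional centre manifold with coordinates $u_c=\sum_{j=\pm1,\pm2,\pm3}u_j\mathrm{e}^{\mathrm{i}\mathbf{k}_j\cdot\mathbf{x}}E_0$, $\mathbf{k}_1=(1,0)$, $\mathbf{k}_2=(-1/2,\sqrt3/2)$, $\mathbf{k}_3=-(1/2,\sqrt3/2)$, $\mathbf{k}_{-j}=-\mathbf{k}_j$. The linearisation of the reduced ODE in stripes in index ordering $(1,-1,2,-3,3,-2)$ is $\mathrm{diag}(L_1,L_2^{\rm hex},L_2^{\rm hex})+\mathcal{O}(\varepsilon^3)$ with $$L_2^{\rm hex}=\varepsilon^2\begin{pmatrix}\lambda'_{\mu,2}+A'^2\eta&2A'\frac{q}{\varepsilon}+A'p(\mu_1)\\2A'\frac{q}{\varepsilon}+A'\overline{p(\mu_1)}&\lambda'_{\mu,2}+A'^2\eta\end{pmatrix},$$ $\lambda'_{\mu,2}=\alpha'+\frac14\rho_\beta\beta'^2+\rho_\kappa\kappa'^2+\mathcal{O}(\varepsilon)$ (real), $q=\langle Q[E_0,E_0],E_0^*\rangle$, $\eta=6k_0+2q_0+8q_1$, $q_1=\langle Q[E_0,Q_1],E_0^*\rangle$, $Q_1=(-k_c^2D+L)^{-1}(\langle Q[E_0,E_0],E_0^*\rangle E_0-Q[E_0,E_0])$, $p(\mu_1)=\langle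 Q[\mathrm{i}\beta'w_{A\beta}+4\kappa'w_{A\kappa},E_0],E_0^*\rangle+\langle(-4\kappa'k_cD-\mathrm{i}\beta'k_cB)Q_1,E_0^*\rangle$. *)

(* Defs.v *)
From HB Require Import structures.
From mathcomp Require Import all_boot all_order all_algebra.
From mathcomp Require Import all_classical all_reals all_analysis.
From mathcomp Require Import complex.
Set Implicit Arguments.
Unset Strict Implicit.
Unset Printing Implicit Defensive.
Import Order.TTheory GRing.Theory Num.Theory.
Import numFieldNormedType.Exports.
Local Open Scope classical_set_scope.
Local Open Scope complex_scope.
Local Open Scope ring_scope.

(* Bilinear: on complex vectors paired with (the image of) a real vector this
   agrees with the Hermitian product, linear in its first argument. *)
Definition dot (F : comNzRingType) (u v : 'cV[F]_2) : F :=
  \sum_i u i 0 * v i 0.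

Definition diag2 (F : nzRingType) (a b : F) : 'M[F]_2 :=
  \matrix_(i, j) (if i == j then (if i == 0 then a else b) else 0).

Definition mxC (R : realType) m n (X : 'M[R]_(m, n)) : 'M[R[i]]_(m, n) :=
  map_mx (real_complex R) X.

Definition sym_bilinear (R : realType)
    (Q : 'cV[R]_2 -> 'cV[R]_2 -> 'cV[R]_2) : Prop :=
  (forall u v, Q u v = Q v u) /\ (forall v, linear (fun u => Q u v)).

Definition sym_trilinear (R : realType)
    (K : 'cV[R]_2 -> 'cV[R]_2 -> 'cV[R]_2 -> 'cV[R]_2) : Prop :=
  [/\ forall u v w, K u v w = K v u w,
      forall u v w, K u v w = K u w v
    & forall v w, linear (fun u => K u v w)].

(* C-bilinear extension of a real bilinear map. *)
Definition bilinC (R : realType) (Q : 'cV[R]_2 -> 'cV[R]_2 -> 'cV[R]_2)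
    (u v : 'cV[R[i]]_2) : 'cV[R[i]]_2 :=
  \sum_i \sum_j (u i 0 * v j 0) *: mxC (Q (delta_mx i 0) (delta_mx j 0)).

(* Linear part of
     u_t = D Delta u + L u + alc M u + beta B(c) u_x + Q[u,u] + K[u,u,u],
   with D = diag(d1, d2), critical wavenumber kc and kernel vectors
   E0 and E0s (the latter standing for E_0^* ). *)
Record linear_part (R : realType) := LinearPart {
  d1 : R;
  d2 : R;
  Lm : 'M[R]_2;
  Mm : 'M[R]_2;
  kc : R;
  E0 : 'cV[R]_2;
  E0s : 'cV[R]_2
}.

Section Linear.
Context (R : realType) (P : linear_part R).

Definition Dm : 'M[R]_2 := diag2 (d1 P) (d2 P).

Definition Bm (c : R) : 'M[R]_2 := diag2 (1 + c) c.

Definition Lhat (alc : R[i]) (beta c k l : R) : 'M[R[i]]_2 :=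
  mxC (- (k ^+ 2 + l ^+ 2) *: Dm + Lm P) + alc *: mxC (Mm P)
  + ('i * (k * beta)%:C) *: mxC (Bm c).

Definition disp (lam alc : R[i]) (beta c k l : R) : R[i] :=
  \det (Lhat alc beta c k l - lam%:M).

Definition lambda_beta : R :=
  (Lm P 1 1 - kc P ^+ 2 * d2 P)
  / (Lm P 0 0 + Lm P 1 1 - kc P ^+ 2 * (d1 P + d2 P)).

(* Partial derivatives of the dispersion relation at lam = alc = beta = 0;
   c is irrelevant there. *)
Definition disp_lam (k l : R) : R[i] :=
  derive1 (fun lam : R[i] => disp lam 0 0 (- lambda_beta) k l : R[i]^o) 0.

Definition disp_alc (k l : R) : R[i] :=
  derive1 (fun alc : R[i] => disp 0 alc 0 (- lambda_beta) k l : R[i]^o) 0.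

(* The quotient is real, and depends on (k, l) only through k^2 + l^2. *)
Definition lambda_M : R := complex.Re (- disp_alc (kc P) 0 / disp_lam (kc P) 0).

Definition turing_instability : Prop :=
  [/\ 0 < kc P,
      forall z : R[i], eigenvalue (mxC (Lm P)) z -> complex.Re z < 0,
      forall (lam : R[i]) (k l : R),
        (disp lam 0 0 (- lambda_beta) k l = 0 /\ 0 <= complex.Re lam)
        <-> (lam = 0 /\ k ^+ 2 + l ^+ 2 = kc P ^+ 2)
    & forall k l : R, k ^+ 2 + l ^+ 2 = kc P ^+ 2 -> disp_lam k l != 0].

Definition Nc : 'M[R]_2 := - kc P ^+ 2 *: Dm + Lm P.

Definition kernel_vectors : Prop :=
  [/\ forall v, Nc *m v = 0 <-> exists a, v = a *: E0 P,
      forall v, Nc^T *m v = 0 <-> exists a, v = a *: E0s P,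
      dot (E0 P) (E0 P) = 1
    & dot (E0 P) (E0s P) = 1].

(* Inverse of Nc from its range to the kernel of <., E0s> E0; the value 0
   outside the range of Nc is never relevant. *)
Definition Ninv (f : 'cV[R]_2) : 'cV[R]_2 :=
  xget 0 [set w | Nc *m w = f /\ dot w (E0s P) *: E0 P = 0].

Definition B0 : 'M[R]_2 := Bm (- lambda_beta).

Definition w_Abeta : 'cV[R]_2 :=
  kc P *: Ninv (dot (B0 *m E0 P) (E0s P) *: E0 P - B0 *m E0 P).

Definition w_Akappa : 'cV[R]_2 := (2 * kc P) *: Ninv (Dm *m E0 P).

Definition rho_beta : R := - kc P * dot (B0 *m w_Abeta) (E0s P).

Definition rho_kappa : R := - 2 * kc P * dot (Dm *m w_Akappa) (E0s P).

End Linear.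

Section Nonlinear.
Context (R : realType) (P : linear_part R).
Context (Q : 'cV[R]_2 -> 'cV[R]_2 -> 'cV[R]_2)
  (K : 'cV[R]_2 -> 'cV[R]_2 -> 'cV[R]_2 -> 'cV[R]_2).

(* E0 is real, so that conjugates of E0 are dropped below. *)
Definition Q_0 : 'cV[R]_2 := - 2 *: (invmx (Lm P) *m Q (E0 P) (E0 P)).

Definition Q_2 : 'cV[R]_2 :=
  - 2 *: (invmx (- 4 * kc P ^+ 2 *: Dm P + Lm P) *m Q (E0 P) (E0 P)).

Definition q_ : R := dot (Q (E0 P) (E0 P)) (E0s P).

Definition Q_1 : 'cV[R]_2 := Ninv P (q_ *: E0 P - Q (E0 P) (E0 P)).

Definition q_0 : R := dot (Q (E0 P) Q_0) (E0s P).
Definition q_1 : R := dot (Q (E0 P) Q_1) (E0s P).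
Definition q_2 : R := dot (Q (E0 P) Q_2) (E0s P).

Definition k_0 : R := dot (K (E0 P) (E0 P) (E0 P)) (E0s P).

Definition rho_nl : R := 3 * k_0 + 2 * q_0 + q_2.

Definition eta : R := 6 * k_0 + 2 * q_0 + 8 * q_1.

Definition p_ (beta' kappa' : R) : R[i] :=
  dot (bilinC Q (('i * beta'%:C) *: mxC (w_Abeta P)
                 + (4 * kappa')%:C *: mxC (w_Akappa P)) (mxC (E0 P)))
      (mxC (E0s P))
  + dot ((- ((4 * kappa' * kc P)%:C *: mxC (Dm P))
          - ('i * (beta' * kc P)%:C) *: mxC (B0 P)) *m mxC Q_1)
        (mxC (E0s P)).

(* r is the O(eps) remainder of lambda'_{mu,2}. *)
Definition L2hex (eps alpha' beta' kappa' A' r : R) : 'M[R[i]]_2 :=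
  let lambda' := alpha' + 4^-1 * rho_beta P * beta' ^+ 2
                 + rho_kappa P * kappa' ^+ 2 + r in
  (eps ^+ 2)%:C *:
  \matrix_(i, j)
    if i == j then (lambda' + A' ^+ 2 * eta)%:C
    else (2 * A' * (q_ / eps))%:C
         + A'%:C * (if i == 0 then p_ beta' kappa'
                    else conjc (p_ beta' kappa')).

(* Wave trains in the frame of velocity beta * c, i.e. y-independent steady
   states of the system above. *)
Definition travelling_wave (alc beta c kappa : R) (u : R -> 'cV[R]_2) : Prop :=
  [/\ forall x, derivable u x 1 /\ derivable (derive1 u) x 1,
      forall x, Dm P *m derive1 (derive1 u) x + Lm P *m u x
                + alc *: (Mm P *m u x) + beta *: (Bm c *m derive1 u x)
                + Q (u x) (u x) + K (u x) (u x) (u x) = 0,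
      forall x, u (x + 2 * pi / kappa) = u x
    & exists x y, u x != u y].

(* The stripe u of amplitude A = eps * A' at
   (alpha, beta, kappa - kc) = (eps^2 alpha', eps beta', eps kappa');
   all O-terms are controlled by the constant C. *)
Definition stripe (C eps alpha' beta' kappa' c A' : R) (u : R -> 'cV[R]_2)
    : Prop :=
  let kappa := kc P + eps * kappa' in
  [/\ travelling_wave (eps ^+ 2 * alpha' / lambda_M P) (eps * beta') c kappa u,
      `|c + lambda_beta P| <= C * eps,
      exists x0, forall x,
        `|u (x + x0) - (2 * eps * A' * cos (kappa * x)) *: E0 P|
          <= C * eps ^+ 2,
      0 < A'
    & exists2 r, `|r| <= C * eps
      & eps ^+ 2 * (alpha' + rho_beta P * beta' ^+ 2
                    + rho_kappa P * kappa' ^+ 2 + rho_nl * A' ^+ 2 + r) = 0].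

End Nonlinear.

Definition A_tilde (R : realType) (P : linear_part R)
    (K : 'cV[R]_2 -> 'cV[R]_2 -> 'cV[R]_2 -> 'cV[R]_2)
    (alpha' beta' kappa' : R) : R :=
  Num.sqrt (- (alpha' + rho_beta P * beta' ^+ 2 + rho_kappa P * kappa' ^+ 2)
            / (3 * k_0 P K)).

(* Main.v *)
(* The matrix is [eps ^+ 2] times a Hermitian matrix with equal real diagonal
   entries [a] and off-diagonal entry [b = A' (2 q' + p)], so its eigenvalues
   are [eps ^+ 2 * (a +- `|b|)].  As [Q = eps Q'], the quantities [Q_0], [Q_1],
   [Q_2] and [p] are O(eps), and [q_0], [q_1], [q_2] are O(eps^2).  The
   existence equation of the stripes then gives [A' = At + O(eps)] (here
   [delta] keeps [At] away from 0, where the square root is not Lipschitz);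
   eliminating [alpha'] from [a] with that equation leaves
   [3 k_0 At^2 - 3/4 rho_beta beta'^2 + O(eps)]. *)
Require Import Defs.
From mathcomp Require Import all_boot all_order all_algebra.
From mathcomp Require Import all_classical all_reals all_analysis.
From mathcomp Require Import complex ring lra.
Import Order.TTheory GRing.Theory Num.Theory.
Import numFieldNormedType.Exports.
Local Open Scope complex_scope.
Local Open Scope ring_scope.

(** * Real-variable perturbation estimates *)

(** Triangle inequality in the plane: the points (s + x, y) and (s, 0) are at distance at most |x| +
    |y|. It serves to compare |2 q' + p| with 2 |q'|, where p = x + i y. *)
Lemma sqrt_sum_sqr_perturb (R : rcfType) (s x y : R) :
  `|Num.sqrt ((s + x) ^+ 2 + y ^+ 2) - `|s| | <= `|x| + `|y|.
Proof.
have upper : Num.sqrt ((s + x) ^+ 2 + y ^+ 2) <= `|s| + `|x| + `|y|.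
  rewrite -[leRHS]ger0_norm ?addr_ge0// -[leRHS]sqrtr_sqr ler_wsqrtr//.
  have h1 : (s + x) ^+ 2 <= (`|s| + `|x|) ^+ 2.
    by rewrite -real_normK ?num_real// lerXn2r ?nnegrE ?addr_ge0// ler_normD.
  rewrite (sqrrD _ `|y|) (real_normK (num_real y)) lerD2r (le_trans h1)//.
  by rewrite lerDl mulrn_wge0// mulr_ge0// addr_ge0.
have lower : `|s + x| <= Num.sqrt ((s + x) ^+ 2 + y ^+ 2).
  by rewrite -[leLHS]sqrtr_sqr ler_wsqrtr// lerDl sqr_ge0.
have tri : `|s| - `|x| <= `|s + x| by rewrite lerB_normD.
have := normr_ge0 y.
by rewrite ler_norml => y0; apply/andP; split; lra.
Qed.

(** The analytic core, with constants depending on [k0], [delta] and [G] only. [S] stands for the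
    part of the existence equation free of [A], [r2] for its remainder, [r] for that of the diagonal
    entry, and [x], [y] for the real and imaginary parts of p. The two bounds concern the diagonal
    entry and the modulus of the off-diagonal one. *)
Lemma amplitude_perturb (R : rcfType) (k0 delta G : R) :
  k0 < 0 -> 0 < delta -> 0 <= G ->
  exists2 eps0 : R, 0 < eps0 & exists2 C' : R, 0 <= C' &
  forall eps S A r r2 q q0 q1 q2 x y : R, 0 < eps < eps0 ->
  delta <= S -> S <= G -> 0 < A -> `|r| <= G * eps -> `|r2| <= G * eps ->
  `|q| <= G -> `|q0| <= G * eps -> `|q1| <= G * eps -> `|q2| <= G * eps ->
  `|x| <= G * eps -> `|y| <= G * eps ->
  S + (3 * k0 + 2 * q0 + q2) * A ^+ 2 + r2 = 0 ->
  let At := Num.sqrt (- S / (3 * k0)) in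
  `|S + r + A ^+ 2 * (6 * k0 + 2 * q0 + 8 * q1) - 3 * k0 * At ^+ 2| <= C' * eps
  /\ `|A * Num.sqrt ((2 * q + x) ^+ 2 + y ^+ 2) - 2 * At * `|q| | <= C' * eps.
Proof.
move=> k0lt0 delta0 G0.
have k1gt0 : 0 < - (3 * k0) by lra.
(* [V] will bound [A ^+ 2] from above, [a] will bound [At] from below, and [D * eps] will bound |A^2
   - At^2|. *)
pose V := (2 * G) / (- (3 * k0) / 2).
pose a := Num.sqrt (delta / (- (3 * k0))).
have a0 : 0 < a by rewrite sqrtr_gt0 divr_gt0.
pose D := (G + 3 * G * V) / (- (3 * k0)).
have V0 : 0 <= V by rewrite divr_ge0//; lra.
have GV0 : 0 <= G * V by rewrite mulr_ge0.
have D0 : 0 <= D by rewrite divr_ge0 ?(ltW k1gt0)//; lra.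
have DaG0 : 0 <= D / a * G by rewrite mulr_ge0// divr_ge0// ltW.
have VG0 : 0 <= V * G by rewrite mulr_ge0.
(* The second entry makes |2 q0 + q2| at most half of |3 k0|; the summand 1 in [G + 1] keeps the
   denominator positive when [G] vanishes. *)
exists (Num.min 1 (- k0 / (2 * (G + 1)))).
  by rewrite lt_min ltr01/= divr_gt0//; lra.
exists (3 * G + 12 * (V * G) + 2 * ((V + 1) * G) + 2 * (D / a * G)); first lra.
move=> eps S A r r2 q q0 q1 q2 x y /andP[eps_gt0].
rewrite lt_min ltr_pdivlMr; last lra.
move=> /andP[eps1 epsG] dS SG A0 rG r2G qG q0G q1G q2G xG yG amp At.
have Geps : 0 <= G * eps by rewrite mulr_ge0// ltW.
have Geps1 : G * eps <= G by rewrite ler_piMr// ltW.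
have Ge2 : 2 * (G * eps) <= - k0 by lra.
have qq : `|2 * q0 + q2| <= 3 * (G * eps).
  move: q0G q2G; rewrite !ler_norml => /andP[? ?] /andP[? ?].
  by apply/andP; split; lra.
(* Half of |3 k0| A^2 absorbs the quadratic corrections; the other half is at most S + r2 <= 2 G. *)
have A2V : A ^+ 2 <= V.
  rewrite ler_pdivlMr; last lra.
  have A20 := sqr_ge0 A.
  have : - (A ^+ 2 * (2 * q0 + q2)) >= - (A ^+ 2 * (- (3 * k0) / 2)).
    rewrite lerN2 ler_wpM2l// (le_trans (ler_norm _))// (le_trans qq)//; lra.
  by move: r2G; rewrite ler_norml => /andP[? ?]; lra.
have AV : A <= V + 1 by have := sqr_ge0 (A - 1); rewrite sqrrB expr1n; lra.
have At2 : At ^+ 2 = S / (- (3 * k0)).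
  rewrite sqr_sqrtr ?invrN ?mulrN ?mulNr//.
  by rewrite -mulrN -invrN divr_ge0 ?ltW//; apply: lt_le_trans dS.
have aAt : a <= At.
  rewrite /At mulNr -mulrN -invrN ler_wsqrtr// ler_pM2r// invr_gt0//.
have diff2 : `|A ^+ 2 - At ^+ 2| <= D * eps.
  have -> : A ^+ 2 - At ^+ 2 = (r2 + (2 * q0 + q2) * A ^+ 2) / (- (3 * k0)).
    rewrite At2; have -> : r2 = - S - (3 * k0 + 2 * q0 + q2) * A ^+ 2 by lra.
    by field; rewrite lt_eqF.
  rewrite normrM normfV (gtr0_norm k1gt0) mulrAC ler_pM2r ?invr_gt0//.
  rewrite (le_trans (ler_normD _ _))// [leRHS]mulrDl lerD//.
  rewrite normrM (ger0_norm (sqr_ge0 A)) mulrAC -(mulrA 3).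
  by rewrite ler_pM ?sqr_ge0.
(* A - At = (A^2 - At^2) / (A + At), where the denominator is at least [a], which is positive thanks
   to [delta]. *)
have diff : `|A - At| <= D / a * eps.
  rewrite mulrAC ler_pdivlMr//; apply: le_trans diff2.
  rewrite subr_sqr normrM ler_wpM2l// (le_trans aAt)// gtr0_norm ?lerDr ?ltW//.
  by rewrite addr_gt0// (lt_le_trans a0).
have VGe : 0 <= V * G * eps by rewrite mulr_ge0// ltW.
have DGe : 0 <= D / a * G * eps by rewrite mulr_ge0// ltW.
clearbody V a D.
split.
  (* Since - 3 k0 At^2 = S, the left side contains 2 S; eliminating [S] by the existence equation
     cancels [k0] and leaves only O(eps) terms. *)
  have -> : S + r + A ^+ 2 * (6 * k0 + 2 * q0 + 8 * q1) - 3 * k0 * At ^+ 2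
      = r - 2 * r2 + A ^+ 2 * (8 * q1 - 2 * q2 - 2 * q0).
    have -> : r2 = - S - (3 * k0 + 2 * q0 + q2) * A ^+ 2 by lra.
    by rewrite At2; field; rewrite lt_eqF.
  have h1 : `|r - 2 * r2| <= 3 * (G * eps).
    move: rG r2G; rewrite !ler_norml => /andP[? ?] /andP[? ?].
    by apply/andP; split; lra.
  have h2 : `|8 * q1 - 2 * q2 - 2 * q0| <= 12 * (G * eps).
    move: q0G q1G q2G; rewrite !ler_norml => /andP[? ?] /andP[? ?] /andP[? ?].
    by apply/andP; split; lra.
  have h3 : `|A ^+ 2 * (8 * q1 - 2 * q2 - 2 * q0)| <= V * (12 * (G * eps)).
    by rewrite normrM (ger0_norm (sqr_ge0 A)) ler_pM ?sqr_ge0.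
  rewrite (le_trans (ler_normD _ _))//.
  by clear -h1 h3 Geps VGe DGe; lra.
have s1 := sqrt_sum_sqr_perturb _ (2 * q) x y.
set m := Num.sqrt _ in s1 *.
(* One error comes from the modulus, weighted by the bounded amplitude, and one from the amplitude,
   weighted by |q|. *)
have -> : A * m - 2 * At * `|q| = A * (m - `|2 * q|) + 2 * ((A - At) * `|q|).
  by rewrite normrM gtr0_norm//; ring.
have h1 : `|A * (m - `|2 * q|)| <= (V + 1) * (2 * (G * eps)).
  rewrite normrM gtr0_norm// ler_pM ?(ltW A0)//.
  by rewrite (le_trans s1)//; lra.
have h2 : `|(A - At) * `|q| | <= D / a * eps * G.
  by rewrite normrM normr_id ler_pM.
have two : `|2| = 2 :> R by rewrite gtr0_norm.
rewrite (le_trans (ler_normD _ _))// (normrM 2 (_ * _)) two.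
by clear -h1 h2 Geps VGe DGe; lra.
Qed.

(** * Two-dimensional linear algebra, complexification and the inverse [Ninv] *)

Lemma ord2P (i : 'I_2) : i = 0 \/ i = 1.
Proof. by case: i => [[|[|//]] ?]; [left|right]; apply/val_inj. Qed.

Lemma colE2 (F : nzRingType) (u : 'cV[F]_2) :
  u = u 0 0 *: delta_mx 0 0 + u 1 0 *: delta_mx 1 0.
Proof.
apply/colP => i; rewrite !mxE.
by case: (ord2P i) => -> /=; rewrite ?mulr1 ?mulr0 ?addr0 ?add0r.
Qed.

Lemma det_mx2 (F : comNzRingType) (M : 'M[F]_2) :
  \det M = M 0 0 * M 1 1 - M 0 1 * M 1 0.
Proof.
rewrite (expand_det_row _ 0) big_ord_recl big_ord1 /cofactor !det_mx11 !mxE /=.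
have -> : lift 0 0 = 1 :> 'I_2 by apply/val_inj.
have -> : lift 1 0 = 0 :> 'I_2 by apply/val_inj.
by rewrite expr0 expr1 mul1r mulN1r mulrN.
Qed.

Lemma normr_mxE (R : realType) m n (M : 'M[R]_(m, n)) i j : `|M i j| <= `|M|.
Proof.
rewrite [leRHS](@mx_normrE R m n M).
by apply: (@le_bigmax _ _ _ 0 (fun ij => `|M ij.1 ij.2|) (i, j)).
Qed.

(** The matrix norm is the maximum of the absolute values of the entries, so the factor 2 counts the
    summands in each entry of the product. *)
Lemma norm_mulmx2 (R : realType) (M : 'M[R]_2) (v : 'cV[R]_2) :
  `|M *m v| <= 2 * `|M| * `|v|.
Proof.
rewrite [leLHS](@mx_normrE R 2 1 (M *m v)); apply/bigmax_leP; split=> [|[i j] _].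
  by rewrite !mulr_ge0.
rewrite /= !mxE (le_trans (ler_norm_sum _ _ _))// big_ord_recl big_ord1.
rewrite -mulrA mulr2n mulrDl mul1r !normrM.
by rewrite lerD// ler_pM// normr_mxE.
Qed.

Lemma norm_dot (R : realType) (u v : 'cV[R]_2) :
  `|dot u v| <= 2 * `|u| * `|v|.
Proof.
rewrite /dot (le_trans (ler_norm_sum _ _ _))// big_ord_recl big_ord1.
rewrite -mulrA mulr2n mulrDl mul1r !normrM.
by rewrite lerD// ler_pM// normr_mxE.
Qed.

Lemma dotDl (F : comNzRingType) (u v w : 'cV[F]_2) :
  dot (u + v) w = dot u w + dot v w.
Proof. by rewrite /dot -big_split; apply: eq_bigr => i _; rewrite mxE mulrDl. Qed.

Lemma dotZl (F : comNzRingType) (a : F) (u w : 'cV[F]_2) :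
  dot (a *: u) w = a * dot u w.
Proof. by rewrite /dot mulr_sumr; apply: eq_bigr => i _; rewrite mxE mulrA. Qed.

Lemma dot0l (F : comNzRingType) (u : 'cV[F]_2) : dot 0 u = 0.
Proof. by rewrite -(scale0r 0) dotZl mul0r. Qed.

Lemma dotC (F : comNzRingType) (u v : 'cV[F]_2) : dot u v = dot v u.
Proof. by apply: eq_bigr => i _; rewrite mulrC. Qed.

Lemma dot_mulmx (F : comNzRingType) (M : 'M[F]_2) (u v : 'cV[F]_2) :
  dot (M *m u) v = dot u (M^T *m v).
Proof.
have dE (a b : 'cV[F]_2) : dot a b = (a^T *m b) 0 0.
  by rewrite !mxE; apply: eq_bigr => i _; rewrite mxE.
by rewrite !dE trmx_mul mulmxA.
Qed.

Lemma dot_mxC (R : realType) (u v : 'cV[R]_2) :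
  dot (mxC u) (mxC v) = (dot u v)%:C.
Proof.
by rewrite /dot rmorph_sum; apply: eq_bigr => i _; rewrite !mxE rmorphM.
Qed.

Lemma bilinC_combl (R : realType) (Q : 'cV[R]_2 -> 'cV[R]_2 -> 'cV[R]_2) a b u v w :
  bilinC Q (a *: u + b *: v) w = a *: bilinC Q u w + b *: bilinC Q v w.
Proof.
rewrite /bilinC !scaler_sumr -big_split; apply: eq_bigr => i _ /=.
rewrite !scaler_sumr -big_split; apply: eq_bigr => j _ /=.
by rewrite !scalerA -scalerDl !mxE; congr (_ *: _); ring.
Qed.

Lemma bilinC_mxC (R : realType) (Q : 'cV[R]_2 -> 'cV[R]_2 -> 'cV[R]_2) u v :
  sym_bilinear Q -> bilinC Q (mxC u) (mxC v) = mxC (Q u v).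
Proof.
move=> [Qsym Qlin].
have lin2 (x y : 'cV[R]_2) : Q x y = x 0 0 *: Q (delta_mx 0 0) y
    + x 1 0 *: Q (delta_mx 1 0) y.
  (* [linear] only gives Q (a u + v) y = a Q u y + Q v y, so vanishing at 0 is extracted first. *)
  have Q0 : Q 0 y = 0.
    have := Qlin y 1 0 0; rewrite !scale1r addr0 => /eqP.
    by rewrite -subr_eq0 opprD addNKr oppr_eq0 => /eqP.
  rewrite {1}[x]colE2 Qlin; congr (_ + _).
  by rewrite -[_ *: delta_mx 1 0]addr0 Qlin Q0 addr0.
rewrite lin2 ![Q (delta_mx _ _) v]Qsym ![Q v _]lin2.
rewrite /bilinC !big_ord_recl !big_ord0 !addr0.
have -> : lift 0 0 = 1 :> 'I_2 by apply/val_inj.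
rewrite (Qsym (delta_mx 1 0) (delta_mx 0 0)).
by apply/matrixP => i j; rewrite !mxE !rmorphD !rmorphM !rmorphD !rmorphM /=; ring.
Qed.

(** All data are real except for the imaginary unit attached to beta', so the kappa' terms form the
    real part and the beta' terms the imaginary part. *)
Lemma p_ReIm (R : realType) (P : linear_part R) Q (b k : R) :
  sym_bilinear Q ->
  p_ P Q b k =
    (4 * k * (dot (Q (w_Akappa P) (E0 P)) (E0s P)
              - kc P * dot (Dm P *m Q_1 P Q) (E0s P)))
    +i* (b * (dot (Q (w_Abeta P) (E0 P)) (E0s P)
              - kc P * dot (B0 P *m Q_1 P Q) (E0s P))).
Proof.
move=> Qbil; rewrite /p_ bilinC_combl !bilinC_mxC// mulmxBl mulNmx -!scalemxAl.
rewrite /mxC -!map_mxM -/(mxC _) -scaleNr -[X in dot X _ + _ = _]/(_ + _).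
rewrite -scaleNr !dotDl !dotZl !dot_mxC.
by apply/eqP; rewrite eq_complex /=; apply/andP; split; apply/eqP; ring.
Qed.

(* On vectors orthogonal to [E0s] the shifted matrix agrees with [Nc], so its
   inverse extends [Ninv]. *)
Lemma Nc_shift_unit (R : realType) (P : linear_part R) :
  kernel_vectors P -> Nc P + E0 P *m (E0s P)^T \in unitmx.
Proof.
move=> [kerN kerNT dE0 dE0s].
rewrite -unitmx_tr -row_free_unit -kermx_eq0.
apply/eqP/row_matrixP => i; rewrite row0; set x := row i _.
have : x *m (Nc P + E0 P *m (E0s P)^T)^T = 0.
  by apply/sub_kermxP; rewrite row_sub.
rewrite -[x in x *m _]trmxK -trmx_mul => /(congr1 trmx); rewrite trmxK trmx0.
set v := x^T.
have dE (a c : 'cV[R]_2) : a *m (E0s P)^T *m c = dot c (E0s P) *: a.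
  rewrite -mulmxA; apply/colP => j; rewrite !mxE big_ord1 !mxE mulrC.
  by congr (_ * _); apply: eq_bigr => l _; rewrite !mxE mulrC.
rewrite mulmxDl dE => eq0.
have NT0 : (Nc P)^T *m E0s P = 0 by apply/kerNT; exists 1; rewrite scale1r.
(* Pairing with [E0s] removes the [Nc] term, as [E0s] lies in the kernel of the transpose. Then [v]
   is a multiple of [E0], and the normalisation makes it 0. *)
have dv0 : dot v (E0s P) = 0.
  have := congr1 (fun w => dot w (E0s P)) eq0.
  rewrite dotDl dotZl dE0s mulr1 dot_mulmx NT0.
  by rewrite dotC !dot0l add0r.
have /kerN[a va] : Nc P *m v = 0 by move: eq0; rewrite dv0 scale0r addr0.
have a0 : a = 0 by move: dv0; rewrite va dotZl dE0s mulr1.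
by rewrite -[x]trmxK -/v va a0 scale0r trmx0.
Qed.

(** [Ninv] is defined by choice, so the bound goes through the shifted matrix: a chosen preimage is
    the image of [f] under its [invmx], and without a preimage the value is the default 0. *)
Lemma Ninv_norm (R : realType) (P : linear_part R) : kernel_vectors P ->
  exists2 c : R, 0 <= c & forall f, `|Ninv P f| <= c * `|f|.
Proof.
move=> hE; have unitN := Nc_shift_unit _ _ hE.
exists (2 * `|invmx (Nc P + E0 P *m (E0s P)^T)|); first by rewrite mulr_ge0.
move=> f; rewrite /Ninv; case: xgetP => [w _ [Nw dw]|_]; last first.
  by rewrite normr0 !mulr_ge0.
suff -> : w = invmx (Nc P + E0 P *m (E0s P)^T) *m f by apply: norm_mulmx2.
apply: (canRL (mulKmx unitN)); rewrite mulmxDl Nw -[RHS]addr0; congr (_ + _).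
rewrite -dw -mulmxA; apply/colP => j; rewrite !mxE big_ord1 !mxE mulrC.
by congr (_ * _); apply: eq_bigr => l _; rewrite !mxE mulrC.
Qed.

(** * Orders of magnitude in the quadratic term Q *)

(** The constant [c] is uniform in Q and [e], so the same bounds serve Q' with e = |C| and Q = eps
    Q' with e = eps |C|. *)
Definition bounded_of_order (R : realType) (V : normedZmodType R) n
    (F : ('cV[R]_2 -> 'cV[R]_2 -> 'cV[R]_2) -> V) : Prop :=
  exists2 c : R, 0 <= c & forall (e : R) Q, 0 <= e ->
    (forall v w, `|Q v w| <= e * `|v| * `|w|) -> `|F Q| <= c * e ^+ n.

Section BoundedOfOrder.
Context (R : realType).
Implicit Types (u v : 'cV[R]_2).

Lemma bounded_of_orderD (V : normedZmodType R) n F G :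
  bounded_of_order R V n F -> bounded_of_order R V n G ->
  bounded_of_order R V n (fun Q => F Q + G Q).
Proof.
move=> [a a0 aF] [b b0 bG]; exists (a + b); first exact: addr_ge0.
move=> e Q e0 Qe; rewrite (le_trans (ler_normD _ _))// mulrDl lerD//.
  exact: aF.
exact: bG.
Qed.

Lemma bounded_of_orderN (V : normedZmodType R) n F :
  bounded_of_order R V n F -> bounded_of_order R V n (fun Q => - F Q).
Proof.
by move=> [a a0 aF]; exists a => // e Q e0 Qe; rewrite normrN; exact: aF.
Qed.

Lemma bounded_of_orderM n (a : R) F :
  bounded_of_order R R n F -> bounded_of_order R R n (fun Q => a * F Q).
Proof.
move=> [b b0 bF]; exists (`|a| * b); first exact: mulr_ge0.
by move=> e Q e0 Qe; rewrite normrM -mulrA ler_wpM2l// bF.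
Qed.

Lemma bounded_of_orderZ n (a : R) F :
  bounded_of_order R 'cV[R]_2 n F ->
  bounded_of_order R 'cV[R]_2 n (fun Q => a *: F Q).
Proof.
move=> [b b0 bF]; exists (`|a| * b); first exact: mulr_ge0.
by move=> e Q e0 Qe; rewrite mx_normZ -mulrA ler_wpM2l// bF.
Qed.

Lemma bounded_of_orderZv n u F :
  bounded_of_order R R n F ->
  bounded_of_order R 'cV[R]_2 n (fun Q => F Q *: u).
Proof.
move=> [b b0 bF]; exists (b * `|u|); first exact: mulr_ge0.
by move=> e Q e0 Qe; rewrite mx_normZ mulrAC ler_wpM2r// bF.
Qed.

Lemma bounded_of_order_mulmx n (M : 'M[R]_2) F :
  bounded_of_order R 'cV[R]_2 n F ->
  bounded_of_order R 'cV[R]_2 n (fun Q => M *m F Q).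
Proof.
move=> [b b0 bF]; exists (2 * `|M| * b); first by rewrite !mulr_ge0.
move=> e Q e0 Qe; rewrite (le_trans (norm_mulmx2 _ _ _))// -[leRHS]mulrA.
by rewrite ler_wpM2l ?mulr_ge0// bF.
Qed.

Lemma bounded_of_order_dot n u F :
  bounded_of_order R 'cV[R]_2 n F ->
  bounded_of_order R R n (fun Q => dot (F Q) u).
Proof.
move=> [b b0 bF]; exists (2 * `|u| * b); first by rewrite !mulr_ge0.
move=> e Q e0 Qe; rewrite (le_trans (norm_dot _ _ _))// mulrAC -[leRHS]mulrA.
by rewrite ler_wpM2l ?mulr_ge0// bF.
Qed.

Lemma bounded_of_order_form u v :
  bounded_of_order R 'cV[R]_2 1 (fun Q => Q u v).
Proof.
exists (`|u| * `|v|); first by rewrite mulr_ge0.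
by move=> e Q e0 Qe; rewrite expr1 mulrC mulrA.
Qed.

(** The outer Q supplies the extra power of [e]. *)
Lemma bounded_of_order_apply n u F :
  bounded_of_order R 'cV[R]_2 n F ->
  bounded_of_order R 'cV[R]_2 n.+1 (fun Q => Q u (F Q)).
Proof.
move=> [b b0 bF]; exists (`|u| * b); first by rewrite mulr_ge0.
move=> e Q e0 Qe; rewrite (le_trans (Qe _ _))//.
have -> : `|u| * b * e ^+ n.+1 = e * `|u| * (b * e ^+ n) by rewrite exprS; ring.
by rewrite ler_wpM2l ?mulr_ge0// bF.
Qed.

Lemma bounded_of_order_Ninv (P : linear_part R) n F : kernel_vectors P ->
  bounded_of_order R 'cV[R]_2 n F ->
  bounded_of_order R 'cV[R]_2 n (fun Q => Ninv P (F Q)).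
Proof.
move=> hE [b b0 bF]; have [c c0 cN] := Ninv_norm _ _ hE.
exists (c * b); first exact: mulr_ge0.
by move=> e Q e0 Qe; rewrite (le_trans (cN _))// -mulrA ler_wpM2l// bF.
Qed.

End BoundedOfOrder.

(** [q_], [Q_0], [Q_1], [Q_2] and [p_] are of first order in Q; [q_0], [q_1], [q_2] apply Q once
    more to [Q_0], [Q_1], [Q_2] and are of second order. *)
Lemma coefficient_bounds (R : realType) (P : linear_part R) :
  kernel_vectors P ->
  exists2 G : R, 0 <= G & forall (e : R) Q, 0 <= e -> sym_bilinear Q ->
  (forall v w, `|Q v w| <= e * `|v| * `|w|) ->
  [/\ `|q_ P Q| <= G * e, `|q_0 P Q| <= G * e ^+ 2, `|q_1 P Q| <= G * e ^+ 2,
      `|q_2 P Q| <= G * e ^+ 2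
    & forall b k, exists x y, [/\ p_ P Q b k = x +i* y,
        `|x| <= `|k| * (G * e) & `|y| <= `|b| * (G * e)]].
Proof.
move=> hE.
have bq : bounded_of_order R R 1 (q_ P).
  exact/bounded_of_order_dot/bounded_of_order_form.
have bQ1 : bounded_of_order R 'cV[R]_2 1 (Q_1 P).
  apply: bounded_of_order_Ninv hE _; apply: bounded_of_orderD.
    exact: bounded_of_orderZv.
  exact/bounded_of_orderN/bounded_of_order_form.
have [g gge0 bg] := bq.
have [g0 g0ge0 bg0] : bounded_of_order R R 2 (q_0 P).
  apply/bounded_of_order_dot/bounded_of_order_apply/bounded_of_orderZ.
  exact/bounded_of_order_mulmx/bounded_of_order_form.
have [g1 g1ge0 bg1] : bounded_of_order R R 2 (q_1 P).
  exact/bounded_of_order_dot/bounded_of_order_apply.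
have [g2 g2ge0 bg2] : bounded_of_order R R 2 (q_2 P).
  apply/bounded_of_order_dot/bounded_of_order_apply/bounded_of_orderZ.
  exact/bounded_of_order_mulmx/bounded_of_order_form.
(* One statement for both parts of p: [Dm], [w_Akappa] and 4 give the real part up to the factor
   kappa', while [B0], [w_Abeta] and 1 give the imaginary part up to beta'. *)
have bp (M : 'M[R]_2) (w : 'cV[R]_2) (a : R) : bounded_of_order R R 1
    (fun Q => a * (dot (Q w (E0 P)) (E0s P)
                   - kc P * dot (M *m Q_1 P Q) (E0s P))).
  apply/bounded_of_orderM/bounded_of_orderD.
    exact/bounded_of_order_dot/bounded_of_order_form.
  exact/bounded_of_orderN/bounded_of_orderM/bounded_of_order_dot/
    bounded_of_order_mulmx.
have [gx gxge0 bgx] := bp (Dm P) (w_Akappa P) 4.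
have [gy gyge0 bgy] := bp (B0 P) (w_Abeta P) 1.
exists (g + g0 + g1 + g2 + gx + gy); first lra.
move=> e Q e0 Qbil Qe; have e20 : 0 <= e ^+ 2 by apply: exprn_ge0.
have enlarge c (z t : R) : c <= g + g0 + g1 + g2 + gx + gy -> 0 <= t ->
    z <= c * t -> z <= (g + g0 + g1 + g2 + gx + gy) * t.
  by move=> cG t0 /le_trans; apply; rewrite ler_wpM2r.
split.
- by have := bg e Q e0 Qe; rewrite expr1 => ?; apply: (enlarge g) => //; lra.
- by apply: (enlarge g0) (bg0 e Q e0 Qe); lra.
- by apply: (enlarge g1) (bg1 e Q e0 Qe); lra.
- by apply: (enlarge g2) (bg2 e Q e0 Qe); lra.
move=> b k; rewrite (p_ReIm _ P Q b k Qbil).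
eexists; eexists; split; first by [].
  rewrite mulrAC mulrC normrM ler_wpM2l//.
  by have := bgx e Q e0 Qe; rewrite expr1 => ?; apply: (enlarge gx) => //; lra.
rewrite normrM ler_wpM2l//.
have := bgy e Q e0 Qe; rewrite expr1 mul1r => ?.
by apply: (enlarge gy) => //; lra.
Qed.

(** * Spectrum of the Hermitian block and conclusion *)

(** With m the modulus of x + i y, det (s M - z) = (s a - z)^2 - s^2 m^2, a difference of squares
    that splits into the two factors. *)
Lemma eigenvalue_hermitian2 (R : rcfType) (M : 'M[R[i]]_2) (s a x y : R) z :
  M 0 0 = a%:C -> M 1 1 = a%:C -> M 0 1 = x +i* y -> M 1 0 = x -i* y ->
  eigenvalue (s%:C *: M) z <->
    z = (s * (a + Num.sqrt (x ^+ 2 + y ^+ 2)))%:C \/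
    z = (s * (a - Num.sqrt (x ^+ 2 + y ^+ 2)))%:C.
Proof.
move=> M00 M11 M01 M10; set m := Num.sqrt _.
have m2 : m ^+ 2 = x ^+ 2 + y ^+ 2 by rewrite sqr_sqrtr// addr_ge0 ?sqr_ge0.
have -> : eigenvalue (s%:C *: M) z =
    ((z - (s * (a + m))%:C) * (z - (s * (a - m))%:C) == 0).
  rewrite /eigenvalue /eigenspace kermx_eq0 row_free_unit unitmxE unitfE negbK.
  rewrite det_mx2 !mxE /= M00 M11 M01 M10; congr (_ == 0).
  have mm : (x +i* y) * (x -i* y) = (m%:C) ^+ 2.
    rewrite -rmorphXn m2; apply/eqP; rewrite eq_complex /=.
    by apply/andP; split; apply/eqP; ring.
  rewrite !mulr0n !mulr1n !subr0 mulrACA mm !rmorphM rmorphD rmorphB /=; ring.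
by rewrite mulf_eq0 !subr_eq0; split=> [/orP[] /eqP|[] ->]; rewrite ?eqxx ?orbT; auto.
Qed.

Theorem theorem3p12 (R : realType) (P : linear_part R)
    (K : 'cV[R]_2 -> 'cV[R]_2 -> 'cV[R]_2 -> 'cV[R]_2)
    (hd1 : 0 < d1 P) (hd2 : 0 < d2 P)
    (hT : turing_instability P)
    (hM : lambda_M P != 0)
    (hE : kernel_vectors P)
    (hK : sym_trilinear K)
    (hk0 : k_0 P K < 0)
    (C delta : R) (hdelta : 0 < delta) :
  exists2 eps0 : R, 0 < eps0 &
  exists C' : R,
  forall (eps : R) (Q' : 'cV[R]_2 -> 'cV[R]_2 -> 'cV[R]_2)
    (alpha' beta' kappa' c A' r : R) (u : R -> 'cV[R]_2),
  let Q := fun v w => eps *: Q' v w in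
  let q' := q_ P Q' in
  let At := A_tilde P K alpha' beta' kappa' in
  0 < eps < eps0 ->
  sym_bilinear Q' ->
  (forall v w, `|Q' v w| <= C * `|v| * `|w|) ->
  rho_nl P Q K < 0 ->
  `|alpha'| <= C -> `|beta'| <= C -> `|kappa'| <= C ->
  delta <= alpha' + rho_beta P * beta' ^+ 2 + rho_kappa P * kappa' ^+ 2 ->
  stripe P Q K C eps alpha' beta' kappa' c A' u ->
  `|r| <= C * eps ->
  exists rp rm : R,
  [/\ `|rp| <= C' * eps, `|rm| <= C' * eps &
   forall z : R[i],
     eigenvalue (L2hex P Q K eps alpha' beta' kappa' A' r) z
     <-> z = (eps ^+ 2 * (3 * k_0 P K * At ^+ 2
               - 3 / 4 * rho_beta P * beta' ^+ 2
               + 2 * At * `|q'| + rp))%:C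
      \/ z = (eps ^+ 2 * (3 * k_0 P K * At ^+ 2
               - 3 / 4 * rho_beta P * beta' ^+ 2
               - 2 * At * `|q'| + rm))%:C].
Proof.
have [Gc Gc0 coefs] := coefficient_bounds _ P hE.
(* [C] carries no sign, so |C| replaces it in products of bounds. *)
pose C1 : R := `|C|.
have C10 : 0 <= C1 by apply: normr_ge0.
have CC1 : C <= C1 by apply: ler_norm.
(* [C1] covers alpha' and the remainders, the next summand completes the bound on [S], [Gc * C1]
   covers q', and [Gc * C1 ^+ 2] covers p, [q_0], [q_1] and [q_2] after a factor eps is taken
   out. *)
pose G : R := C1 + (`|rho_beta P| + `|rho_kappa P|) * C1 ^+ 2 + Gc * C1
  + Gc * C1 ^+ 2.
have C120 : 0 <= C1 ^+ 2 by apply: sqr_ge0.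
have t1 : 0 <= (`|rho_beta P| + `|rho_kappa P|) * C1 ^+ 2.
  by rewrite mulr_ge0// addr_ge0.
have t2 : 0 <= Gc * C1 by rewrite mulr_ge0.
have t3 : 0 <= Gc * C1 ^+ 2 by rewrite mulr_ge0.
have G0 : 0 <= G by rewrite !addr_ge0.
have [eps0 eps0gt0 [C' C'0 amp]] := amplitude_perturb _ _ _ _ hk0 hdelta G0.
(* The bound eps < 1 weakens the O(eps^2) estimates of [q_0], [q_1], [q_2] to O(eps). *)
exists (Num.min 1 eps0); first by rewrite lt_min ltr01.
(* Each eigenvalue collects one diagonal and one off-diagonal error, hence the factor 2. *)
exists (2 * C') => eps Q' alpha' beta' kappa' c A' r u Q q' At.
rewrite lt_min => /and3P[eps_gt0 eps_lt1 eps_lt0] Q'bil Q'C _ aC bC kC dS.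
move=> [_ _ _ A'0 [r2 r2C ampE0]] rC.
move/eqP: ampE0; rewrite mulf_eq0 expf_eq0/= gt_eqF//= => /eqP ampE.
have Q'C1 v w : `|Q' v w| <= C1 * `|v| * `|w|.
  by rewrite (le_trans (Q'C v w))// -!mulrA ler_wpM2r// mulr_ge0.
have [q'G _ _ _ _] := coefs C1 Q' C10 Q'bil Q'C1.
have Qbil : sym_bilinear Q.
  case: Q'bil => Q'sym Q'lin; split=> [v w|w a v v']; rewrite /Q.
    by rewrite Q'sym.
  by rewrite Q'lin scalerDr !scalerA mulrC.
have QC v w : `|Q v w| <= (eps * C1) * `|v| * `|w|.
  rewrite /Q mx_normZ gtr0_norm// -!mulrA ler_pM2l//.
  by rewrite [leRHS]mulrA; exact: Q'C1.
have epsC0 : 0 <= eps * C1 by rewrite mulr_ge0// ltW.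
have [_ q0G q1G q2G pG] := coefs _ Q epsC0 Qbil QC.
have [x [y [pE xG yG]]] := pG beta' kappa'.
have CG : C1 * eps <= G * eps by rewrite ler_pM2r// /G; lra.
have sq_eps : Gc * (eps * C1) ^+ 2 <= G * eps.
  have -> : Gc * (eps * C1) ^+ 2 = Gc * C1 ^+ 2 * eps * eps by ring.
  rewrite ler_pM2r//.
  have : Gc * C1 ^+ 2 * eps <= Gc * C1 ^+ 2 by rewrite ler_piMr// ltW.
  by move/le_trans; apply; rewrite /G; lra.
have lin_eps (z : R) : `|z| <= C -> `|z| * (Gc * (eps * C1)) <= G * eps.
  move=> zC; apply: (@le_trans _ _ (C1 * (Gc * (eps * C1)))).
    by apply: ler_wpM2r; [exact: mulr_ge0|exact: le_trans zC CC1].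
  have -> : C1 * (Gc * (eps * C1)) = (Gc * C1 ^+ 2) * eps by ring.
  by rewrite ler_pM2r// /G; lra.
have q'G' : `|q'| <= G by rewrite (le_trans q'G)// /G; lra.
have sqC (z : R) : `|z| <= C -> z ^+ 2 <= C1 ^+ 2.
  by move=> zC; rewrite -real_normK ?num_real// lerXn2r ?nnegrE// (le_trans zC).
set S := alpha' + _ + _ in dS ampE.
have SG : S <= G.
  have h1 : rho_beta P * beta' ^+ 2 <= `|rho_beta P| * C1 ^+ 2.
    apply: (le_trans (ler_norm _)); rewrite normrM ler_wpM2l// ger0_norm ?sqr_ge0//.
    exact: sqC.
  have h2 : rho_kappa P * kappa' ^+ 2 <= `|rho_kappa P| * C1 ^+ 2.
    apply: (le_trans (ler_norm _)); rewrite normrM ler_wpM2l// ger0_norm ?sqr_ge0//.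
    exact: sqC.
  have h3 : alpha' <= C1 by rewrite (le_trans (ler_norm _))// (le_trans aC).
  by rewrite /S /G mulrDl; lra.
have rG : `|r| <= G * eps by rewrite (le_trans rC)// (le_trans _ CG)// ler_pM2r.
have r2G : `|r2| <= G * eps by rewrite (le_trans r2C)// (le_trans _ CG)// ler_pM2r.
have eps_range : 0 < eps < eps0 by rewrite eps_gt0.
have [diagE offE] := amp eps S A' r r2 q' (q_0 P Q) (q_1 P Q) (q_2 P Q) x y
  eps_range dS SG A'0 rG r2G q'G' (le_trans q0G sq_eps) (le_trans q1G sq_eps)
  (le_trans q2G sq_eps) (le_trans xG (lin_eps _ kC)) (le_trans yG (lin_eps _ bC))
  ampE.
rewrite -[Num.sqrt (- S / _)]/At in diagE offE.
(* [e1] is the error of the diagonal entry and [e2] that of the off-diagonal modulus; the two signs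
   of the square root give the remainders [e1 + e2] and [e1 - e2]. *)
set e1 := _ - 3 * k_0 P K * At ^+ 2 in diagE.
set e2 := _ - _ * `|q'| in offE.
exists (e1 + e2), (e1 - e2).
have err (s : R) : `|s| <= C' * eps -> `|e1 + s| <= 2 * C' * eps.
  by move=> sC; rewrite (le_trans (ler_normD _ _))//; lra.
split; [exact: err|by apply: err; rewrite normrN|] => z.
(* Here Q = eps Q' cancels the division by eps in the off-diagonal entry. *)
have q_Q : q_ P Q / eps = q' by rewrite /q_ /Q dotZl mulrAC mulfV ?gt_eqF// mul1r.
rewrite /L2hex (eigenvalue_hermitian2 _ _ _
  (alpha' + 4^-1 * rho_beta P * beta' ^+ 2 + rho_kappa P * kappa' ^+ 2 + r
     + A' ^+ 2 * eta P Q K) (A' * (2 * q' + x)) (A' * y)).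
- have -> : Num.sqrt ((A' * (2 * q' + x)) ^+ 2 + (A' * y) ^+ 2)
      = 2 * At * `|q'| + e2.
    rewrite !exprMn -mulrDr sqrtrM ?sqr_ge0// sqrtr_sqr gtr0_norm//.
    by rewrite /e2 [RHS]addrC subrK.
  (* As 1/4 = 1 - 3/4, the diagonal entry is S - 3/4 rho_beta beta'^2 + r + A'^2 eta. *)
  have -> : alpha' + 4^-1 * rho_beta P * beta' ^+ 2 + rho_kappa P * kappa' ^+ 2
      + r + A' ^+ 2 * eta P Q K
      = 3 * k_0 P K * At ^+ 2 - 3 / 4 * rho_beta P * beta' ^+ 2 + e1.
    by rewrite /e1 /eta /S; field.
  by split=> -[] ->; [left|right|left|right]; congr (_ * _)%:C; ring.
- by rewrite mxE.
- by rewrite mxE.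
- rewrite mxE /= pE q_Q; apply/eqP; rewrite eq_complex /=.
  by apply/andP; split; apply/eqP; ring.
- rewrite mxE /= pE q_Q; apply/eqP; rewrite eq_complex /=.
  by apply/andP; split; apply/eqP; ring.
Qed.
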